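(* Let $G \le \mathrm{Sym}(\Omega)$ be a finite primitive permutation group. If $b(G) > 2$ and the Common Neighbour Conjecture holds for $G$ (that is, any two vertices of the generalised Saxl graph $\Sigma(G)$ share a common neighbour), then the gossip number $g_2$ of $G$ satisfies $g_2 \ge 2$. On the other hand, for every integer $b \ge 2$ there exists a finite primitive permutation group $G$ with base size $b(G) = b$ such that its gossip number $g_3$ equals $0$.
   Context: For a permutation group $G \le \mathrm{Sym}(\Omega)$, a subset $B \subseteq \Omega$ is a base if its pointwise stabiliser in $G$ is trivial; the base size $b(G)$ is the minimum size of a base. The Saxl hypergraph $\mathcal{H}(G)$ has vertex set $\Omega$ and as edges all bases for $G$ of size $b(G)$. For $b(G)\ge 2$, the generalised Saxl graph $\Sigma(G)$ is the graph on $\Omega$ in which two distinct points are adjacent if and only if they lie together in some base for $G$ of size $b(G)$. In a (hyper)graph, two distinct vertices are adjacent (neighbours) if they belong to a common edge; $N_\Gamma(v)$ is the set of neighbours of $v$. For a graph or hypergraph $\Gamma=(V,E)$ and an integer $n$, the $n$th gossip number is $$g_n = \min_{S \in V^n} \left|\bigcap_{v \in S} N_\Gamma(v)\right|$$ if $1 \le n \le |V|$ (the minimum being over $n$-tuples $S$ of vertices, and the intersection over the entries of $S$), and $g_n = 0$ otherwise. The graph $\Sigma(G)$ and the hypergraph $\mathcal{H}(G)$ have the same neighbourhoods, hence the same gossip numbers, which are called the gossip numbers of $G$. *)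

(* Defs.v *)
From mathcomp Require Import all_boot all_order all_fingroup all_solvable.

Set Implicit Arguments.
Unset Strict Implicit.
Unset Printing Implicit Defensive.

Section Hypergraphs.

(* A graph or hypergraph on the vertex set T is given by its set of edges     *)
(* E : {set {set T}}; the edges of a graph have exactly two elements.         *)

Variable T : finType.
Implicit Types (E : {set {set T}}) (x y v : T) (n : nat).

Definition adjacent E : rel T :=
  fun x y => (x != y) && [exists e in E, (x \in e) && (y \in e)].

Definition neighbours E v : {set T} := [set w | adjacent E v w].

Definition common_neighbours E (s : seq T) : {set T} :=
  \bigcap_(v <- s) neighbours E v.

(* The entries of a tuple S may coincide. The initial value #|T| bounds every *)
(* term and does not affect the minimum, because n-tuples exist when          *)
(* 1 <= n <= #|T| (see gossip_attained and gossip_le).                        *)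
Definition gossip E n : nat :=
  if 1 <= n <= #|T|
  then \big[minn/#|T|]_(S : n.-tuple T) #|common_neighbours E S|
  else 0.

Definition any_two_share_neighbour E : Prop :=
  forall x y, x != y -> exists z, z \in neighbours E x :&: neighbours E y.

Lemma gossip_le E n (S : n.-tuple T) :
  1 <= n <= #|T| -> gossip E n <= #|common_neighbours E S|.
Proof.
by move=> hn; rewrite /gossip hn; apply: (@Order.TotalTheory.bigmin_le_cond _ nat).
Qed.

Lemma gossip_attained E n : 1 <= n <= #|T| ->
  exists S : n.-tuple T, gossip E n = #|common_neighbours E S|.
Proof.
move=> hn; have /card_gt0P[x0 _] : 0 < #|T|.
  by case/andP: hn; apply: leq_trans.
pose F (S : n.-tuple T) := #|common_neighbours E S|.
exists [arg min_(S < nseq_tuple n x0) F S]%O; rewrite /gossip hn.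
apply: (@Order.TotalTheory.bigmin_eq_arg _ nat _ _ _ predT F) => // S _.
exact: max_card.
Qed.

End Hypergraphs.

Section Saxl.

Variables (T : finType) (G : {group {perm T}}).
Implicit Types B : {set T}.

Definition is_base B : bool := ('C_G(B | 'P) == 1)%g.

Lemma is_base_setT : is_base [set: T].
Proof.
apply/eqP/trivgP/subsetP=> s /setIP[_ /astabP fix_s].
by apply/set1gP/permP=> x; rewrite perm1; apply: fix_s; rewrite inE.
Qed.

Definition base_size : nat := #|[arg min_(B < [set: T] | is_base B) #|B|]|.

Lemma base_sizeP :
  (exists2 B, is_base B & #|B| = base_size) /\
  (forall B, is_base B -> base_size <= #|B|).
Proof.
rewrite /base_size; case: arg_minnP => [|B baseB minB]; first exact: is_base_setT.
by split=> //; exists B.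
Qed.

Definition saxl_hypergraph : {set {set T}} :=
  [set B | is_base B && (#|B| == base_size)].

Definition saxl_graph : {set {set T}} :=
  [set [set p.1; p.2] | p : T * T
     & (p.1 != p.2) && [exists B in saxl_hypergraph, (p.1 \in B) && (p.2 \in B)]].

Lemma neighbours_saxl : neighbours saxl_graph =1 neighbours saxl_hypergraph.
Proof.
move=> v; apply/setP=> w; rewrite !inE /adjacent; case: eqVneq => //= neq_vw.
apply/exists_inP/idP=> [[e]|ex].
- case/imsetP=> -[x y] /=; rewrite inE /= => /andP[_ /exists_inP[B HB /andP[Bx By]]].
  move=> -> /andP[/set2P hv /set2P hw]; apply/exists_inP; exists B => //.
  by case: hv => ->; case: hw => ->; rewrite ?Bx ?By.
- exists [set v; w]; last by rewrite set21 set22.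
  by apply/imsetP; exists (v, w) => //; rewrite inE /= neq_vw.
Qed.

Definition gossip_number (n : nat) : nat := gossip saxl_graph n.

Lemma gossip_number_hypergraph n : gossip_number n = gossip saxl_hypergraph n.
Proof.
rewrite /gossip_number /gossip; case: ifP => // _.
apply: eq_bigr => S _; congr #|pred_of_set _|.
by apply: eq_bigr => v _; apply: neighbours_saxl.
Qed.

Definition common_neighbour_conjecture : Prop :=
  any_two_share_neighbour saxl_graph.

End Saxl.

(* Main.v *)
Require Import Defs.
From mathcomp Require Import all_boot all_order all_fingroup all_solvable all_algebra.
From mathcomp Require Import zify.

(* For the second half, let [G] be the product action of [S_3 wr S_d] on       *)
(* [F_3 ^ d] with [d = (3 ^ m - 1) / 2]. Translating one of its points to 0    *)
(* and reading the remaining [k] points as the rows of a matrix over [F_3], a  *)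
(* base is a set of points for which the [d] columns are nonzero and pairwise  *)
(* non-proportional. Hence [k >= m], the points of the projective space        *)
(* PG(m-1, 3) provide a base with [k = m], and the base size is [m + 1]. The   *)
(* same count in the columns with a zero in a given row shows that two         *)
(* adjacent points agree in at most [(3 ^ (m - 1) - 1) / 2] coordinates. But   *)
(* every point agrees in [d] coordinates altogether with the three constant    *)
(* vectors, and [d > 3 * (3 ^ (m - 1) - 1) / 2], so these have no common       *)
(* neighbour.                                                                  *)

Set Implicit Arguments.
Unset Strict Implicit.
Unset Printing Implicit Defensive.

(** [G] acts by automorphisms on its Saxl hypergraph, so a unique common neighbour of two points is
    fixed by their joint stabiliser. The exchange argument in [card_common_neighbours] excludes
    this, which gives the first half. In the second half, the one count [hamming_base_card] bounds
    the base size from below and the agreement of adjacent points from above; [code_points_base]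
    gives a base of the least size, and [hamming_primitive] gives primitivity. *)

(** * Exchange in minimal bases and the bound on g_2 *)

Section Bases.

Variables (T : finType) (G : {group {perm T}}).
Implicit Types (B : {set T}) (x y z : T).

Lemma is_baseP B :
  reflect (forall s, s \in G -> {in B, forall x, s x = x} -> s = 1%g)
          (is_base G B).
Proof.
apply: (iffP eqP) => [C1 s Gs fixB | C1].
  by apply/set1gP; rewrite -C1 inE Gs; apply/astabP.
apply/trivgP/subsetP=> s /setIP[Gs /astabP fixB].
by apply/set1gP; apply: C1.
Qed.

Lemma saxl_neighboursP x y :
  reflect [/\ x != y & exists B, [/\ is_base G B, #|B| = base_size G,
                                     x \in B & y \in B]]
          (y \in neighbours (saxl_hypergraph G) x).
Proof.
rewrite inE; apply: (iffP andP) => -[neq_xy].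
  case/exists_inP=> B; rewrite inE => /andP[baseB /eqP cardB] /andP[Bx By].
  by split=> //; exists B.
case=> B [baseB cardB Bx By]; split=> //.
by apply/exists_inP; exists B; rewrite ?inE ?baseB ?cardB ?Bx ?By /=.
Qed.

Lemma base_size_le B : is_base G B -> base_size G <= #|B|.
Proof. by case: (base_sizeP G) => _; apply. Qed.

(* If [z] were the only common neighbour of [x <> y], then the stabiliser of  *)
(* [x] and [y] would fix [z], so that replacing [z] by [y] in a minimal base  *)
(* through [x] and [z] would again give a minimal base; its third point would *)
(* be another common neighbour.                                               *)
Lemma card_common_neighbours x y :
    2 < base_size G -> common_neighbour_conjecture G -> x != y ->
  1 < #|neighbours (saxl_hypergraph G) x :&: neighbours (saxl_hypergraph G) y|.
Proof.
move=> b_gt2 cnc neq_xy; set N := _ :&: _.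
have [z] := cnc x y neq_xy; rewrite !neighbours_saxl -/N => Nz.
rewrite ltnNge; apply/negP=> /card_le1_eqP N1.
have uniq_z w : w \in N -> w = z by move=> Nw; apply: N1.
have [/saxl_neighboursP[neq_xz [B [baseB cardB Bx Bz]]]] := setIP Nz.
move=> /saxl_neighboursP[neq_yz _].
have fix_z s : s \in G -> s x = x -> s y = y -> s z = z.
  move=> Gs sx sy; apply: uniq_z.
  have adjs v w : w \in neighbours (saxl_hypergraph G) v ->
      s w \in neighbours (saxl_hypergraph G) (s v).
    case/saxl_neighboursP=> neq_vw [A [/is_baseP baseA cardA Av Aw]].
    apply/saxl_neighboursP; split; first by rewrite (inj_eq perm_inj).
    exists (s @: A); split; rewrite ?imset_f ?card_imset //; last exact: perm_inj.
    apply/is_baseP=> t Gt fixA; apply/eqP.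
    rewrite -(conjg_eq1 _ s^-1)%g; apply/eqP/baseA.
      by rewrite groupJ ?groupV.
    move=> a Aa; rewrite conjgE invgK !permM fixA ?imset_f //.
    by rewrite permK.
  have [Nxz Nyz] := setIP Nz.
  by apply/setIP; split; [rewrite -sx | rewrite -sy]; apply: adjs.
pose B' := y |: B :\ z.
have B'x : x \in B' by rewrite !inE neq_xz Bx orbT.
have B'y : y \in B' by rewrite !inE eqxx.
have baseB' : is_base G B'.
  apply/is_baseP=> s Gs fixB'; move/is_baseP: baseB; apply=> // w Bw.
  have [->|neq_wz] := eqVneq w z; first by apply: fix_z => //; apply: fixB'.
  by apply: fixB'; rewrite !inE neq_wz Bw orbT.
have cardB' : #|B'| = base_size G.
  apply/eqP; rewrite eqn_leq base_size_le // andbT cardsU1 -cardB.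
  by rewrite (cardsD1 z B) Bz leq_add2r leq_b1.
have [w B'w] : exists2 w, w \in B' & w \notin [set x; y].
  apply/subsetPn/negP=> /subset_leq_card; rewrite cardB' cards2 neq_xy.
  by rewrite leqNgt b_gt2.
rewrite !inE negb_or => /andP[neq_wx neq_wy].
suff wz : w = z by move: B'w; rewrite wz !inE eqxx eq_sym (negbTE neq_yz).
apply: uniq_z; apply/setIP.
by split; apply/saxl_neighboursP; (split; first by rewrite eq_sym); exists B'.
Qed.

Lemma gossip_number2_ge2 :
  2 < base_size G -> common_neighbour_conjecture G -> 2 <= gossip_number G 2.
Proof.
move=> b_gt2 cnc; rewrite gossip_number_hypergraph.
have T_gt2 : 2 < #|T|.
  by have [[B _ cardB] _] := base_sizeP G; rewrite (leq_trans b_gt2) // -cardB max_card.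
have [|S ->] := @gossip_attained _ (saxl_hypergraph G) 2; first exact: ltnW.
case: S => [[|x [|y []]]] //= _; rewrite /common_neighbours.
rewrite !big_cons big_nil setIT.
(* For a repeated entry, the neighbours of [x] include its common neighbours with any other
   point. *)
have [<-|] := eqVneq x y; last exact: card_common_neighbours.
have [y' neq_yx] : exists y', x != y'.
  have /card_gt1P[u [v [_ _ neq_uv]]] := ltnW T_gt2.
  by have [eq_xu|] := eqVneq x u; [exists v; rewrite eq_xu | exists u].
apply: leq_trans (card_common_neighbours b_gt2 cnc neq_yx) _.
by rewrite setIid subset_leq_card // subsetIl.
Qed.

End Bases.

(** * The product action of S_3 wr Sym(I): primitivity and bases *)

Section HammingGroup.

Import GRing.Theory.
Local Open Scope ring_scope.

Variable I : finType.
Local Notation T := {ffun I -> 'F_3}.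
Implicit Types (i j k : I) (a c : 'F_3) (x y z u : T) (B : {set T}).

Lemma F3_third a b c c' :
  b != a -> c != a -> c != b -> c' != a -> c' != b -> c' = c.
Proof.
move=> ba ca cb c'a c'b; apply/eqP; move: ba ca cb c'a c'b.
by move: a b c c'; do 4![case=> [[|[|[|?]]] ?] //=].
Qed.

Lemma F3_sign c : c != 0 -> (c == 1) || (c == -1).
Proof. by case: c => [[|[|[|]]]]. Qed.

Lemma F3_inv c : c != 0 -> c^-1 = c.
Proof. by case/F3_sign/orP=> /eqP->; rewrite ?invrN invr1. Qed.

(* The full wreath product of [Sym(F_3)] with [Sym(I)] in its product action: *)
(* each coordinate of [s x] depends bijectively on some coordinate of [x].    *)
Definition hamming_set : {set {perm T}} :=
  [set s : {perm T} | [forall i, exists j, forall x : T, forall y : T,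
                         (s x i == s y i) == (x j == y j)]].

Lemma hammingP (s : {perm T}) :
  reflect (forall i, exists j, forall x y, (s x i == s y i) = (x j == y j))
          (s \in hamming_set).
Proof.
rewrite inE; apply: (iffP forallP) => H i.
  have /existsP[j /forallP Hj] := H i; exists j => x y.
  by have /forallP/(_ y)/eqP := Hj x.
have [j Hj] := H i; apply/existsP; exists j.
by apply/forallP=> x; apply/forallP=> y; rewrite Hj.
Qed.

Lemma hamming_group_set : group_set hamming_set.
Proof.
apply/group_setP; split=> [|s t /hammingP Hs /hammingP Ht]; apply/hammingP=> i.
  by exists i => x y; rewrite !perm1.
by have [j Hj] := Ht i; have [k Hk] := Hs j; exists k => x y; rewrite !permM Hj.
Qed.
Canonical hamming_group := Group hamming_group_set.

(** The transposition of coordinates [i] and [j], scaled by [c] on both and translated so that [x]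
    goes to [u]. *)
Definition affine_swap i j c x u z : T :=
  [ffun k => u k + (if (k == i) || (k == j) then c else 1)
                   * (z (tperm i j k) - x (tperm i j k))].

Lemma affine_swapK i j c x u : c != 0 ->
  forall y z k, (affine_swap i j c x u y k == affine_swap i j c x u z k)
                = (y (tperm i j k) == z (tperm i j k)).
Proof.
move=> c0 y z k; rewrite !ffunE (inj_eq (addrI _)) (inj_eq (mulfI _)).
  by rewrite (inj_eq (addIr _)).
by case: ifP => // _; apply: oner_neq0.
Qed.

Lemma affine_swapE i j c x u : c != 0 ->
  exists2 s, s \in hamming_group & s =1 affine_swap i j c x u.
Proof.
move=> c0; have K := affine_swapK i j x u c0.
have inj : injective (affine_swap i j c x u).
  move=> y z /ffunP eq_yz; apply/ffunP=> k; apply/eqP.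
  by have /eqP := eq_yz (tperm i j k); rewrite K tpermK.
exists (perm inj); last exact: permE.
by apply/hammingP=> k; exists (tperm i j k) => y z; rewrite !(permE inj) K.
Qed.

Lemma affine_swap_id i j c x u : affine_swap i j c x u x = u.
Proof. by apply/ffunP=> k; rewrite ffunE subrr mulr0 addr0. Qed.

Lemma hamming_trans : [transitive hamming_group, on [set: T] | 'P].
Proof.
apply/imsetP; exists 0 => //; apply/eqP; rewrite eq_sym eqEsubset subsetT /=.
apply/subsetP=> u _; have [j _|I0] := pickP (@predT I); last first.
  suff -> : u = 0 by apply: orbit_refl.
  by apply/ffunP=> i; have := I0 i.
have [s Gs sE] := affine_swapE j j 0 u (oner_neq0 _).
by apply/orbitP; exists s; rewrite //= apermE sE affine_swap_id.
Qed.

(** If a block contains [x] and [y] with [x i != y i], reflecting coordinate [i] about [x i] fixes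
    the block and changes [y] in that coordinate only. By homogeneity, any two points differing in
    one coordinate share a block, so there is only one block. *)
Lemma hamming_primitive : [primitive hamming_group, on [set: T] | 'P].
Proof.
rewrite /primitive hamming_trans /=; apply/existsP=> -[Q /and3P[partQ actQ]].
have [/eqP covQ tiQ Q0] := and3P partQ.
have inQ x : pblock Q x \in Q by rewrite pblock_mem ?covQ.
have mem_pb x : x \in pblock Q x by rewrite mem_pblock covQ.
have pbG s x : s \in hamming_group ->
    pblock Q (s x) = ('P^* (pblock Q x) s)%act.
  move=> Gs; apply: def_pblock => //; first by rewrite (actsP actQ).
  by rewrite -[s x]/('P x s)%act; apply: imset_f.
have inv s x y : s \in hamming_group ->
    pblock Q x = pblock Q y -> pblock Q (s x) = pblock Q (s y).
  by move=> Gs eq_xy; rewrite !pbG // eq_xy.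
case/andP=> Q_gt1 ltQT.
have /injectivePn[x [y neq_xy pb_xy]] : ~~ injectiveb (pblock Q).
  apply: contraL ltQT => /injectiveP injQ; rewrite -leqNgt -(card_imset _ injQ).
  by apply/subset_leq_card/subsetP=> _ /imsetP[x _ ->].
have [i neq_i] : exists i, x i != y i.
  by apply/existsP; apply: contraNT neq_xy => /existsPn eq_xy;
    apply/eqP/ffunP=> i; apply/eqP/negPn.
have N1 : -1 != 0 :> 'F_3 by [].
have [s Gs sE0] := affine_swapE i i x x N1.
have sE k : s y k = if k == i then x i - (y i - x i) else y k.
  rewrite sE0 ffunE tperm1 perm1 orbb; case: eqP => [->|_]; first by rewrite mulN1r.
  by rewrite mul1r addrC subrK.
have sx : s x = x by rewrite sE0 affine_swap_id.
have pb_sy : pblock Q (s y) = pblock Q y by rewrite -(inv _ _ _ Gs pb_xy) sx.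
have neq_sy : s y i - y i != 0.
  by rewrite sE eqxx; move: (x i) (y i) neq_i; do 2![case=> [[|[|[|?]]] ?] //=].
have step k (u v : T) : (forall l, l != k -> u l = v l) -> pblock Q u = pblock Q v.
  move=> eq_uv; have [eq_k|neq_k] := eqVneq (v k - u k) 0.
    congr (pblock Q _); apply/ffunP=> l; have [->|/eq_uv//] := eqVneq l k.
    by apply/esym/eqP; rewrite -subr_eq0 eq_k.
  (* This scaling makes the swap of [i] and [k] carry the pair [y], [s y] to [u], [v]. *)
  pose c := (v k - u k) / (s y i - y i).
  have c0 : c != 0 by rewrite mulf_neq0 ?invr_eq0.
  have [t Gt tE] := affine_swapE i k y u c0.
  have <- : t y = u by rewrite tE affine_swap_id.
  suff <- : t (s y) = v by rewrite (inv _ _ _ Gt pb_sy).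
  apply/ffunP=> l; rewrite tE ffunE; have [->|neq_lk] := eqVneq l k.
    by rewrite orbT tpermR divfK // addrC subrK.
  rewrite -eq_uv // sE (canF_eq (tpermK i k)) tpermL (negbTE neq_lk).
  by rewrite subrr mulr0 addr0.
have pb0 (r : seq I) (u : T) : pblock Q [ffun l => if l \in r then u l else 0] = pblock Q 0.
  elim: r => [|k r IHr].
    by congr (pblock Q _); apply/ffunP=> l; rewrite !ffunE.
  rewrite -IHr; apply: (step k) => l neq_lk.
  by rewrite !ffunE in_cons (negbTE neq_lk).
move: Q_gt1; rewrite ltnNge => /negP; apply.
apply: (@leq_trans #|[set pblock Q 0]|); last by rewrite cards1.
apply/subset_leq_card/subsetP=> P QP.
have [P0|[u Pu]] := set_0Vmem P; first by rewrite P0 (negbTE Q0) in QP.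
rewrite inE -(def_pblock tiQ QP Pu) -(pb0 (enum I) u); apply/eqP.
by congr (pblock Q _); apply/ffunP=> l; rewrite ffunE mem_enum.
Qed.

(** If [s] fixes [B] pointwise, coordinate [i] of [s x] depends on a coordinate with the same
    equality pattern on [B], hence on [i] itself. The induced permutation of F_3 fixes two values,
    so also the third. *)
Lemma hamming_base B :
    (forall i, exists x y, [/\ x \in B, y \in B & x i != y i]) ->
    (forall i j, {in B &, forall x y, (x i == y i) = (x j == y j)} -> i = j) ->
  is_base hamming_group B.
Proof.
move=> sepB distB; apply/is_baseP=> s /hammingP Gs fixB.
apply/permP=> x; rewrite perm1; apply/ffunP=> i.
have [j Hj] := Gs i.
have {j Hj} Hi y z : (s y i == s z i) = (y i == z i).
  by rewrite Hj -(distB i j) // => {}y {}z By Bz; rewrite -Hj !fixB.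
have [a [b [Ba Bb neq_ab]]] := sepB i.
have [xa|neq_xa] := eqVneq (x i) (a i).
  by apply/eqP; have := Hi x a; rewrite (fixB a) // xa eqxx.
have [xb|neq_xb] := eqVneq (x i) (b i).
  by apply/eqP; have := Hi x b; rewrite (fixB b) // xb eqxx.
apply: (@F3_third (a i) (b i)) => //; first by rewrite eq_sym.
  by have := Hi x a; rewrite (fixB a) // => ->.
by have := Hi x b; rewrite (fixB b) // => ->.
Qed.

(* With [i = j] and [c = -1] this says that no column is zero, and with       *)
(* [i <> j] that no two columns are proportional.                             *)
Lemma hamming_base_columns B x i j c : is_base hamming_group B -> c != 0 ->
  {in B, forall y, y j - x j = c * (y i - x i)} -> i = j /\ c = 1.
Proof.
move=> /is_baseP baseB c0 col.
have [s Gs sE] := affine_swapE i j x x c0.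
have s1 : s = 1%g.
  apply: baseB => // y By; rewrite sE; apply/ffunP=> k; rewrite ffunE.
  case: tpermP => [->|->|/eqP neq_ki /eqP neq_kj].
  - rewrite eqxx col // mulrA -{1}[c]F3_inv // mulVf //.
    by rewrite mul1r addrC subrK.
  - by rewrite eqxx orbT -col // addrC subrK.
  by rewrite (negbTE neq_ki) (negbTE neq_kj) mul1r addrC subrK.
(* At coordinate [j] of this point, [s = 1] reads [(j == i)%:R = c]. *)
pose z : T := [ffun k => x k + (k == i)%:R].
have := congr1 (fun f : T => f j) (sE z).
rewrite s1 perm1 !ffunE tpermR eqxx orbT eqxx [x i + 1]addrC addrK mulr1.
by move/addrI => cE; move: c0; rewrite -cE; case: (eqVneq j i) => [->|_].
Qed.

(** The nonzero multiples of the columns that vanish on [A] are distinct nonzero functions supported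
    on [B :\: A], by [hamming_base_columns]; the zero function makes the inequality strict. *)
Lemma hamming_base_card B (A : {set T}) x : is_base hamming_group B ->
    A \subset B ->
  (2 * #|[set i | [forall y in A, y i == x i]]| < 3 ^ (#|B| - #|A|))%N.
Proof.
move=> baseB sAB; set J := [set i | _].
pose h (p : I * 'F_3) : {ffun T -> 'F_3} :=
  [ffun y => if y \in B then p.2 * (y p.1 - x p.1) else 0].
pose D := setX J [set~ 0 : 'F_3].
have cardD : #|D| = (2 * #|J|)%N by rewrite cardsX cardsC1 card_ord mulnC.
have inj_h : {in D &, injective h}.
  move=> [i c] [j d] /setXP[_ c0] /setXP[_ d0] /ffunP eq_h.
  rewrite !inE /= in c0 d0.
  have c'd0 : c / d != 0 by rewrite mulf_neq0 ?invr_eq0.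
  have [y By|-> cd1] := @hamming_base_columns B x i j (c / d) baseB c'd0.
    by have := eq_h y; rewrite !ffunE By /= mulrAC => ->; rewrite mulrC mulKf.
  by rewrite -[c](divfK d0) cd1 mul1r.
pose f0 : {ffun T -> 'F_3} := [ffun=> 0].
have h_neq0 : f0 \notin h @: D.
  apply/imsetP=> -[[i c] /setXP[_]]; rewrite !inE /= => c0 /ffunP h0.
  have N1 : -1 != 0 :> 'F_3 by [].
  have [y By|_] // := @hamming_base_columns B x i i (-1) baseB N1.
  have /esym := h0 y; rewrite !ffunE By => /eqP; rewrite mulf_eq0 (negbTE c0) /= => /eqP->.
  by rewrite mulr0.
rewrite -cardD -(card_in_imset inj_h).
have -> : #|h @: D|.+1 = #|f0 |: h @: D| by rewrite cardsU1 h_neq0.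
have -> : (3 ^ (#|B| - #|A|) = #|pffun_on (0%R : 'F_3) (B :\: A) 'F_3|)%N.
  by rewrite card_pffun_on card_ord cardsD (setIidPr sAB).
apply/subset_leq_card/subsetP=> f /setU1P[->|/imsetP[[i c] /setXP[Ji _] ->]].
  by apply/pffun_onP; split=> //; apply/subsetP=> y; rewrite inE ffunE eqxx.
apply/pffun_onP; split=> //; apply/subsetP=> y.
rewrite !inE ffunE /=; case: ifP => By; last by rewrite eqxx.
rewrite andbT; apply: contra => Ay.
move: Ji; rewrite inE => /forall_inP/(_ y Ay)/eqP->.
by rewrite subrr mulr0.
Qed.

Lemma hamming_base_size_ge : (2 * #|I| < 3 ^ (base_size hamming_group).-1)%N.
Proof.
have [[B baseB <-] _] := base_sizeP hamming_group.
have lt_card (A : {set T}) x : A \subset B -> A \subset [set x] ->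
    (2 * #|I| < 3 ^ (#|B| - #|A|))%N.
  move=> sAB sAx; have := hamming_base_card x baseB sAB.
  suff -> : [set i | [forall y in A, y i == x i]] = [set: I] by rewrite cardsT.
  by apply/setP=> i; rewrite !inE; apply/forall_inP=> y /(subsetP sAx)/set1P->.
(* For empty [B] both truncated exponents are 0; otherwise [A] is a single point of [B]. *)
have [B0|[x Bx]] := set_0Vmem B.
  by have := lt_card set0 0 (sub0set _) (sub0set _); rewrite B0 cards0.
by have := lt_card [set x] x; rewrite sub1set cards1 subn1; apply.
Qed.

Lemma agreement_lt x v :
    v \in neighbours (saxl_hypergraph hamming_group) x ->
  (2 * #|[set i | v i == x i]| < 3 ^ (base_size hamming_group - 2))%N.
Proof.
case/saxl_neighboursP=> neq_xv [B [baseB <- Bx Bv]].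
have sAB : [set x; v] \subset B by apply/subsetP=> y /set2P[] ->.
have := hamming_base_card x baseB sAB; rewrite cards2 neq_xv.
apply: leq_ltn_trans; rewrite leq_mul2l /=; apply/subset_leq_card/subsetP=> i.
by rewrite !inE => vi; apply/forall_inP=> y /set2P[] ->.
Qed.

(* Every coordinate of [v] agrees with one of the three constant vectors. *)
Lemma gossip_number3_hamming :
    (3 ^ (base_size hamming_group).-1 <= (2 * #|I|).+1)%N ->
    (1 < base_size hamming_group)%N ->
  gossip_number hamming_group 3 = 0%N.
Proof.
move=> leI b_gt1; rewrite gossip_number_hypergraph; set E := saxl_hypergraph _.
(* With fewer than three points, [gossip] is 0 by default. *)
have [T3|T3] := boolP (1 <= 3 <= #|{: T}|)%N; last by rewrite /gossip (negbTE T3).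
pose cst c : T := [ffun=> c].
apply/eqP; rewrite -leqn0.
apply: leq_trans (gossip_le E [tuple cst 0; cst 1; cst (-1)] T3) _.
rewrite leqn0 cards_eq0; apply: contraLR leI => /set0Pn[v].
rewrite /common_neighbours !big_cons big_nil setIT -ltnNge.
pose J c := [set i | v i == cst c i].
have J_lt c : v \in neighbours E (cst c) ->
    (2 * #|J c| < 3 ^ (base_size hamming_group - 2))%N.
  exact: agreement_lt.
case/setIP=> /J_lt v0 /setIP[/J_lt v1 /J_lt v2].
have leI : (#|I| <= #|J 0%R| + (#|J 1%R| + #|J (-1)%R|))%N.
  rewrite -cardsT; apply: leq_trans (leq_add (leqnn _) (leq_card_setU _ _)).
  apply: leq_trans (leq_card_setU _ _); apply/subset_leq_card/subsetP=> i _.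
  rewrite !inE !ffunE; have [->//|/F3_sign] := eqVneq (v i) 0.
  by rewrite orbC.
case: base_size b_gt1 {J_lt} v0 v1 v2 => [|[|b]] // _; rewrite !subSS subn0 /= expnS.
by move: leI; move: #|I| #|J 0| #|J 1| #|J (-1)| (3 ^ b)%N; lia.
Qed.

End HammingGroup.

(** * The points of PG(m-1, 3) as coordinates *)

Section ProjectiveCode.

Import GRing.Theory.
Local Open Scope ring_scope.

Variable m : nat.
Local Notation V := {ffun 'I_m -> 'F_3}.

(* One vector out of each pair [v], [- v] with [v != 0]: the points of the    *)
(* projective space of dimension [m - 1] over [F_3].                          *)
Definition half_space : finType := {v : V | (enum_rank v < enum_rank (- v)%R)%N}.

Lemma card_half_space : (3 ^ m <= (2 * #|half_space|).+1)%N.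
Proof.
have -> : (3 ^ m = #|{: V}|)%N by rewrite card_ffun !card_ord.
pose H := [set v : V | (enum_rank v < enum_rank (- v)%R)%N].
have cardH : #|H| = #|half_space|.
  by rewrite card_sig; apply: eq_card => v; rewrite !inE.
pose N (v : V) : V := - v.
have cardNH : (#|N @: H| <= #|H|)%N by apply: leq_imset_card.
have : (#|{: V}| <= #|[set 0%R : V]| + (#|H| + #|N @: H|))%N.
  rewrite -cardsT; apply: leq_trans (leq_add (leqnn _) (leq_card_setU _ _)).
  apply: leq_trans (leq_card_setU _ _); apply/subset_leq_card/subsetP=> v _.
  rewrite !in_setU in_set1 inE.
  case: ltngtP => [_|lt|/val_inj/enum_rank_inj/eqP]; first by rewrite orbT.
    by rewrite -[v]opprK (imset_f N) ?orbT // inE opprK.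
  rewrite -subr_eq0 opprK => /eqP v0; suff -> : v = 0 by rewrite eqxx.
  apply/ffunP=> k; have := congr1 (fun f : V => f k) v0; rewrite !ffunE.
  by case: (v k) => [[|[|[|?]]] ?] // _; apply/val_inj.
rewrite cards1 cardH; move: cardNH; rewrite cardH; lia.
Qed.

(** The zero row, and the rows of a parity-check matrix of the ternary Hamming code. *)
Definition code_points : {set {ffun half_space -> 'F_3}} :=
  [ffun=> 0] |: [set [ffun v : half_space => val v k] | k : 'I_m].

(** Over F_3 the zeros and equalities among the entries determine a column up to sign, and
    [half_space] never contains both signs. *)
Lemma code_points_base : is_base (hamming_group half_space) code_points.
Proof.
have in0 : [ffun=> 0] \in code_points by rewrite setU11.
have ink k : [ffun v : half_space => val v k] \in code_points.
  by apply/setU1P; right; apply: imset_f.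
apply: hamming_base => [v|v w eq_vw].
  have [k vk0] : exists k, val v k != 0.
    apply/existsP; have := valP v; apply: contraLR => /existsPn v0.
    suff -> : val v = 0 by rewrite oppr0 ltnn.
    by apply/ffunP=> k; rewrite ffunE; apply/eqP/negPn.
  by exists [ffun u : half_space => val u k], [ffun=> 0]; split=> //; rewrite !ffunE.
have eq0 k : (val v k == 0) = (val w k == 0).
  by have := eq_vw _ _ (ink k) in0; rewrite !ffunE.
have eqk k l : (val v k == val v l) = (val w k == val w l).
  by have := eq_vw _ _ (ink k) (ink l); rewrite !ffunE.
have [/existsP[k]|/existsPn eq_v_w] :=
  boolP [exists k, val v k != val w k]; last first.
  by apply/val_inj/ffunP=> k; apply/eqP/negPn.
move=> neq_k; suff vN : val v = - val w.
  by have := valP v; rewrite vN opprK => /(ltn_trans (valP w)); rewrite ltnn.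
apply/ffunP=> l; rewrite !ffunE; apply/eqP.
move: (eq0 k) (eq0 l) (eqk k l) neq_k.
by move: (val v k) (val v l) (val w k) (val w l); do 4![case=> [[|[|[|?]]] ?] //=].
Qed.

Lemma base_size_half_space : (0 < m)%N -> base_size (hamming_group half_space) = m.+1.
Proof.
move=> m_gt0; apply/eqP; rewrite eqn_leq; apply/andP; split.
  apply: leq_trans (base_size_le code_points_base) _.
  rewrite cardsU1; apply: (@leq_add _ _ 1) (leq_b1 _) _.
  by apply: leq_trans (leq_imset_card _ _) _; rewrite card_ord.
have := leq_trans card_half_space (hamming_base_size_ge half_space).
by rewrite leq_exp2l //; case: base_size => // /(leq_trans m_gt0).
Qed.

End ProjectiveCode.

Theorem theorem1p5 :
  (forall (T : finType) (G : {group {perm T}}),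
     [primitive G, on [set: T] | 'P] ->
     2 < base_size G ->
     common_neighbour_conjecture G ->
     2 <= gossip_number G 2)
  /\
  (forall b : nat, 2 <= b ->
     exists (T : finType) (G : {group {perm T}}),
       [/\ [primitive G, on [set: T] | 'P],
           base_size G = b
         & gossip_number G 3 = 0]).
Proof.
split=> [T G _|[|[|m]] // _]; first exact: gossip_number2_ge2.
have bE := @base_size_half_space m.+1 isT.
exists {ffun half_space m.+1 -> 'F_3}, (hamming_group (half_space m.+1)).
split; [exact: hamming_primitive | exact: bE |].
by apply: gossip_number3_hamming; rewrite bE // card_half_space.
Qed.
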